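(* Let $k$ be a positive integer and let $D$ be a strongly connected digraph that contains no subdivision of the oriented cycle $C(k,1,1,1,1,1)$ as a subdigraph. Then $\chi(D)\le 7\cdot 24^2\cdot k$.
   Context: All graphs are simple. The chromatic number $\chi(D)$ of a digraph is the chromatic number of its underlying undirected graph. A block of an oriented path or cycle is a maximal directed subpath. $C(k_1,\dots,k_n)$ denotes the oriented cycle consisting of $n$ blocks of lengths $k_1,\dots,k_n$ in this cyclic order (consecutive blocks have opposite orientations). A subdivision of a digraph $H$ is a digraph obtained from $H$ by replacing each arc $(x,y)$ by a directed path from $x$ to $y$ of length at least $1$, the new paths being internally disjoint. *)

(* Defs.v *)
From mathcomp Require Import all_boot.

Set Implicit Arguments.
Unset Strict Implicit.
Unset Printing Implicit Defensive.

(* A finite digraph is a relation D on a finType; D x y is the arc (x, y).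
   There are no parallel arcs by construction, and loops are excluded by
   [irreflexive D]; opposite arcs (x, y) and (y, x) may coexist. *)

Definition underlying (T : finType) (D : rel T) : rel T :=
  fun x y => D x y || D y x.

Definition strongly_connected (T : finType) (D : rel T) : Prop :=
  forall x y, connect D x y.

Definition colorable (T : finType) (G : rel T) (n : nat) : bool :=
  [exists c : {ffun T -> 'I_n}, [forall x, forall y, G x y ==> (c x != c y)]].

Lemma colorable_ex (T : finType) (G : rel T) :
  irreflexive G -> exists n, colorable G n.
Proof.
move=> irrG; exists #|T|; apply/existsP; exists [ffun x => enum_rank x].
apply/forallP=> x; apply/forallP=> y; apply/implyP=> Gxy.
rewrite !ffunE (inj_eq enum_rank_inj).
by apply: contraTneq Gxy => ->; rewrite irrG.
Qed.

(* Irreflexivity is needed for a proper colouring to exist. *)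
Definition graph_chromatic_number (T : finType) (G : rel T)
    (irrG : irreflexive G) : nat :=
  ex_minn (colorable_ex irrG).

Lemma underlying_irr (T : finType) (D : rel T) :
  irreflexive D -> irreflexive (underlying D).
Proof. by move=> irrD x; rewrite /underlying irrD. Qed.

Definition chromatic_number (T : finType) (D : rel T)
    (irrD : irreflexive D) : nat :=
  graph_chromatic_number (underlying_irr irrD).

(* C(k_1, ..., k_n) for n even, all k_i > 0 and k_1 + ... + k_n >= 3.  The
   i-th edge joins i to its cyclic successor [ordS i] and belongs to the block
   number [reshape_index ks i] (counted from 0); blocks of even number are
   oriented from i to ordS i, the others from ordS i to i. *)
Definition oriented_cycle (ks : seq nat) : rel 'I_(sumn ks) :=
  fun x y => (y == ordS x) && ~~ odd (reshape_index ks x)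
          || (x == ordS y) && odd (reshape_index ks y).
Arguments oriented_cycle : clear implicits.

(* S is a subdivision of H: f x is the vertex of S corresponding to the vertex
   x of H, and p x y lists the internal vertices (possibly none) of the path of
   S from f x to f y that replaces the arc (x, y) of H; p x y is irrelevant
   when (x, y) is not an arc.  The pairs in the zip are the arcs of that path.
   The last two clauses say that S has no other vertices or arcs. *)
Definition subdivision (U V : finType) (H : rel U) (S : rel V) : Prop :=
  exists (f : U -> V) (p : U -> U -> seq V),
  [/\ injective f,
      forall x y, H x y -> uniq (p x y) /\ (forall z, f z \notin p x y),
      forall x y x' y', H x y -> H x' y' -> (x, y) <> (x', y') ->
        forall v, v \in p x y -> v \notin p x' y',
      forall v, (exists x, v = f x) \/ (exists x y, H x y /\ v \in p x y)
    & forall u v, S u v <->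
        exists x y, H x y /\
          (u, v) \in zip (f x :: p x y) (rcons (p x y) (f y))].

Definition subdigraph (V T : finType) (S : rel V) (D : rel T) : Prop :=
  exists g : V -> T, injective g /\ {homo g : u v / S u v >-> D u v}.

Definition contains_subdivision (U T : finType) (H : rel U) (D : rel T) : Prop :=
  exists (V : finType) (S : rel V), subdivision H S /\ subdigraph S D.

(* Main.v *)
Require Import Defs.
From mathcomp Require Import all_boot.
From mathcomp Require Import zify.

(* Fix a spanning out-tree maximizing the sum of the levels: an arc x -> y that
   does not go to a higher level then ends at an ancestor y of x.  After colouring
   by the level modulo k it remains to colour the arcs whose ends have levels at
   distance at least k: the arcs to an ancestor, the arcs to a descendant and the
   arcs between incomparable vertices, which all increase the level.
   - An arc x -> y to an ancestor with five consecutive arcs of the same kind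
     between y and x gives a hexagon; so the largest number of consecutive such
     arcs on the branch of x, modulo 6, is a colouring.
   - An arc x -> y to a descendant with, on the branch between x and y, two
     consecutive pairs of crossing arcs s -> a, b -> t (s < b < a, t not above a)
     gives a hexagon.  So colour by the number of consecutive crossings modulo 3;
     inside one class there are no crossings, and deleting for each tail the
     deepest head and then for each head the deepest tail deletes everything.
   - For incomparable arcs, delete for each head the lowest tail, for each tail
     the highest head, then for each tail the lowest head.  If more than three arcs
     still enter some vertex, then a zigzag of arcs closed up through a least
     common ancestor, or two tails on one branch, give a hexagon.
   This makes k * 6 * 12 * 32 colours. *)

Set Implicit Arguments.
Unset Strict Implicit.
Unset Printing Implicit Defensive.

Lemma count_consE (T : Type) (a : pred T) (x : T) (s : seq T) :
  count a (x :: s) = a x + count a s.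
Proof. by []. Qed.

(** Comparing multiplicities under an arbitrary predicate turns a permutation of concatenations into
    linear arithmetic. *)
Ltac perm_count :=
  apply/permP => ?; rewrite -?cats1 -?cat_cons !(count_cat, count_consE) /= ?addn0;
  clear; repeat (move: (nat_of_bool _) => ?); lia.

(** * Subdivisions of the hexagon C(k,1,1,1,1,1) *)

Lemma zip_map2 (T U : Type) (f : T -> U) (s t : seq T) :
  zip (map f s) (map f t) = [seq (f z.1, f z.2) | z <- zip s t].
Proof. by elim: s t => [|x s IHs] [|y t] //=; rewrite IHs. Qed.

Lemma path_zip (T : eqType) (e : rel T) (x y : T) (p : seq T) (u v : T) :
  path e x (rcons p y) -> (u, v) \in zip (x :: p) (rcons p y) -> e u v.
Proof.
elim: p x => [|z p IHp] x /=.
  by rewrite andbT inE => exy /eqP[-> ->].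
by case/andP=> exz /IHp ezp; rewrite inE => /predU1P[[-> ->]|/ezp].
Qed.

(** The subdivision is built on the subtype of the vertices of [T] in use, with exactly the arcs of
    the chosen paths, so that only conditions inside [D] remain. *)
Lemma embed_subdivision (U T : finType) (H : rel U) (D : rel T)
    (f : U -> T) (p : U -> U -> seq T) :
  injective f ->
  (forall x y, H x y -> uniq (p x y) /\ (forall z, f z \notin p x y)) ->
  (forall x y x' y', H x y -> H x' y' -> (x, y) <> (x', y') ->
     forall v, v \in p x y -> v \notin p x' y') ->
  (forall x y, H x y -> path D (f x) (rcons (p x y) (f y))) ->
  contains_subdivision H D.
Proof.
move=> f_inj p_uniq p_disj p_path.
pose A v := [exists x, f x == v]
  || [exists x, exists y, H x y && (v \in p x y)].
have Af x : A (f x) by apply/orP; left; apply/existsP; exists x.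
have Ap x y v : H x y -> v \in p x y -> A v.
  move=> Hxy pv; apply/orP; right; apply/existsP; exists x.
  by apply/existsP; exists y; rewrite Hxy.
pose f' x : {v | A v} := exist _ (f x) (Af x).
pose p' x y : seq {v | A v} := pmap insub (p x y).
have val_p' x y : H x y -> map val (p' x y) = p x y.
  move=> Hxy; rewrite (pmap_filter (insubK _)); apply/all_filterP/allP => v pv.
  by rewrite isSome_insub (Ap x y).
have mem_p' x y (v : {v | A v}) : H x y -> (v \in p' x y) = (val v \in p x y).
  by move=> Hxy; rewrite -(val_p' x y Hxy) (mem_map val_inj).
pose S (u v : {v | A v}) := [exists x, exists y,
  H x y && ((val u, val v) \in zip (f x :: p x y) (rcons (p x y) (f y)))].
exists {v | A v}, S; split; last first.
  exists val; split=> [|u v]; first exact: val_inj.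
  case/existsP=> x /existsP[y /andP[Hxy]].
  exact: path_zip (p_path x y Hxy).
exists f', p'; split.
- by move=> x y [] /f_inj.
- move=> x y Hxy; have [u_p fp] := p_uniq x y Hxy; split=> [|z].
    by rewrite -(map_inj_uniq val_inj) val_p'.
  by rewrite mem_p' //; apply: fp.
- move=> x y x' y' Hxy Hxy' ne v; 
  rewrite !mem_p' //; exact: (p_disj x y x' y').
- move=> [v Av]; case/orP: (Av) => [/existsP[x /eqP fx]|].
    by left; exists x; apply: val_inj; rewrite /= fx.
  case/existsP=> x /existsP[y /andP[Hxy pv]].
  by right; exists x, y; split=> //; rewrite mem_p'.
move=> u v; have zipE x y : H x y ->
    ((u, v) \in zip (f' x :: p' x y) (rcons (p' x y) (f' y)))
    = ((val u, val v) \in zip (f x :: p x y) (rcons (p x y) (f y))).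
  move=> Hxy; rewrite -(val_p' x y Hxy) -[f x]/(val (f' x)) -[f y]/(val (f' y)).
  rewrite -map_rcons -map_cons zip_map2.
  have val2_inj : injective (fun z : {v | A v} * {v | A v} => (val z.1, val z.2)).
    by move=> [a b] [c d] [] /val_inj-> /val_inj->.
  exact: esym (mem_map val2_inj _ (u, v)).
split=> [/existsP[x /existsP[y /andP[Hxy uv]]]|[x [y [Hxy uv]]]].
  by exists x, y; rewrite zipE.
by apply/existsP; exists x; apply/existsP; exists y; rewrite Hxy -zipE.
Qed.

(** Lets a single [uniq] statement on a concatenation supply the disjointness clauses of a
    subdivision. *)
Lemma flatten_uniq_nth (T : eqType) (ps : seq (seq T)) (i j : nat) (v : T) :
  uniq (flatten ps) -> i <> j -> v \in nth [::] ps i -> v \notin nth [::] ps j.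
Proof.
elim: ps i j => [|p ps IHps] i j /=; first by rewrite nth_nil.
rewrite cat_uniq => /and3P[_ /hasPn disj u_ps].
have sub n : v \in nth [::] ps n -> v \notin p.
  move=> vn; apply: disj; apply/flattenP; exists (nth [::] ps n) => //.
  by rewrite mem_nth // ltnNge; apply: contraL vn => ?; rewrite nth_default.
case: i j => [|i] [|j] //= ne; last by apply: IHps => // eq_ij; rewrite eq_ij in ne.
  by apply: contraL => /sub.
by move/sub.
Qed.

Lemma uniq_flatten_nth (T : eqType) (ps : seq (seq T)) (i : nat) :
  uniq (flatten ps) -> uniq (nth [::] ps i).
Proof.
elim: ps i => [|p ps IHps] i /=; first by rewrite nth_nil.
by rewrite cat_uniq => /and3P[u_p _ u_ps]; case: i => [|i] //=; apply: IHps.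
Qed.

(** Edge [i] lies in block 0 if [i < k] and in block [i - k + 1] otherwise; edge [k + 4] wraps round
    to 0. The sources are 0, [k + 1], [k + 3], the sinks [k], [k + 2], [k + 4]. *)
Lemma oriented_hexagonP (k : nat) (x y : 'I_(sumn [:: k; 1; 1; 1; 1; 1])) :
  oriented_cycle [:: k; 1; 1; 1; 1; 1] x y ->
  [\/ x < k /\ y = x.+1 :> nat,
      x = k.+1 :> nat /\ (y = k :> nat \/ y = k.+2 :> nat),
      x = k.+3 :> nat /\ (y = k.+2 :> nat \/ y = k.+4 :> nat) |
      x = 0 :> nat /\ y = k.+4 :> nat].
Proof.
have idx (z : 'I_(sumn [:: k; 1; 1; 1; 1; 1])) :
    z < k + 5 /\ reshape_index [:: k; 1; 1; 1; 1; 1] z = if z < k then 0 else (z - k).+1.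
  case: z => z /= zlt; split; first lia.
  rewrite /reshape_index /=; case: ltnP => zk; first by rewrite (_ : z.+1 - k = 0) //; lia.
  have : (z - k) < 5 by lia.
  have -> : z.+1 - k = (z - k).+1 by lia.
  by case: (z - k) => [|[|[|[|[|]]]]].
have ordSE (u v : 'I_(sumn [:: k; 1; 1; 1; 1; 1])) : (u == ordS v) ->
    u = (if v < k.+4 then v.+1 else 0) :> nat.
  move/eqP=> ->; have [vlt _] := idx v.
  have -> : ordS v = v.+1 %% (k + 5) :> nat by [].
  case: ltnP => vk; first by rewrite modn_small //; lia.
  have -> : v.+1 = k + 5 by lia.
  exact: modnn.
rewrite /oriented_cycle; have [xlt ->] := idx x; have [ylt ->] := idx y.
case/orP=> /andP[/ordSE].
  case: (ltnP x k) => xk ey par.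
    by apply: Or41; split=> //; move: ey; case: ltnP; lia.
  have xd : x = k + (x - k) :> nat by lia.
  move: par ey xd; have : x - k < 5 by lia.
  case: (x - k) => [|[|[|[|[|d]]]]] // _ _; case: ltnP => ? ey xd; try lia.
    by apply: Or42; lia.
  by apply: Or43; lia.
case: (ltnP y k) => // yk ex par.
have yd : y = k + (y - k) :> nat by lia.
move: par ex yd; have : y - k < 5 by lia.
case: (y - k) => [|[|[|[|[|d]]]]] // _ _; case: ltnP => ? ex yd; try lia.
- by apply: Or42; lia.
- by apply: Or43; lia.
by apply: Or44; lia.
Qed.

(* All extra vertices of the long block are put on its last arc (k - 1, k), which
   has index 0; 6 is the index of the other arcs, which are not subdivided. *)
Definition hexagon_index (k x y : nat) : nat :=
  if (x.+1 == k) && (y == k) then 0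
  else if x == k.+1 then (if y == k then 1 else 2)
  else if x == k.+3 then (if y == k.+2 then 3 else 4)
  else if (x == 0) && (y == k.+4) then 5 else 6.

(** An index below 6 determines its arc, so distinct arcs never share a nonempty list of inserted
    vertices. *)
Lemma hexagon_indexP (k x y : nat) :
  [\/ x < k /\ y = x.+1, x = k.+1 /\ (y = k \/ y = k.+2),
      x = k.+3 /\ (y = k.+2 \/ y = k.+4) | x = 0 /\ y = k.+4] ->
  hexagon_index k x y < 6 ->
  nth (0, 0) [:: (k.-1, k); (k.+1, k); (k.+1, k.+2); (k.+3, k.+2);
                 (k.+3, k.+4); (0, k.+4)] (hexagon_index k x y) = (x, y).
Proof.
rewrite /hexagon_index => -[[xk ->]|[-> ey]|[-> ey]|[-> ->]].
- case: (x.+1 =P k) => [<-|_] //=.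
  have [-> -> ->] // : [/\ (x == k.+1) = false, (x == k.+3) = false
    & (x == 0) && (x.+1 == k.+4) = false] by split; lia.
- rewrite eqxx; have -> /= : (k.+2 == k) = false by clear; lia.
  case: ey => ->; rewrite ?eqxx //.
  by have -> : (k.+2 == k) = false by clear; lia.
- have [-> -> /=] : (k.+4 == k) = false /\ (k.+3 == k.+1) = false.
    by clear; split; lia.
  rewrite eqxx.
  case: ey => ->; rewrite ?eqxx //.
  by have -> : (k.+4 == k.+2) = false by clear; lia.
have -> : (k.+4 == k) = false by clear; lia.
by rewrite andbF /= eqxx.
Qed.

Lemma hexagon_subdivision (T : finType) (D : rel T) (k : nat)
    (s1 t1 s2 t2 s3 t3 : T) (p q1 q2 q3 q4 q5 : seq T) :
  0 < k -> k <= (size p).+1 ->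
  path D s1 (rcons p t1) -> path D s2 (rcons q1 t1) ->
  path D s2 (rcons q2 t2) -> path D s3 (rcons q3 t2) ->
  path D s3 (rcons q4 t3) -> path D s1 (rcons q5 t3) ->
  uniq (s1 :: p ++ t1 :: q1 ++ s2 :: q2 ++ t2 :: q3 ++ s3 :: q4 ++ t3 :: q5) ->
  contains_subdivision (oriented_cycle [:: k; 1; 1; 1; 1; 1]) D.
Proof.
move=> k_gt0 size_p P0 P1 P2 P3 P4 P5 uniqL.
(* The vertices in the numbering of the hexagon: [k] from the long path, then the other five ends of
   blocks. The rest of the long path becomes entry 0 of [ps]. *)
pose vs := take k (s1 :: p) ++ [:: t1; s2; t2; s3; t3].
pose ps := [:: drop k (s1 :: p); q1; q2; q3; q4; q5].
have uniq_vps : uniq (vs ++ flatten ps).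
  move: uniqL; congr is_true; apply/perm_uniq/permP => a.
  have := congr1 (count a) (cat_take_drop k (s1 :: p)).
  rewrite /vs /ps; move: (take k _) (drop k _) => tk dk /=.
  rewrite !(count_cat, count_consE) /= addn0; clear.
  do 6!move: (nat_of_bool _) => ?; lia.
have size_take_k : size (take k (s1 :: p)) = k by rewrite size_takel.
have size_vs : size vs = k + 5 by rewrite size_cat size_take_k.
have vs_lt x : x < k -> nth s1 vs x = nth s1 (s1 :: p) x.
  by move=> xk; rewrite nth_cat size_take_k xk nth_take.
have vs_ge x : nth s1 vs (k + x) = nth s1 [:: t1; s2; t2; s3; t3] x.
  by rewrite nth_cat size_take_k ltnNge leq_addr /= addKn.
pose j := hexagon_index k.
have [uniq_vs /hasPn vs_ps uniq_ps] :
    [/\ uniq vs, ~~ has (mem vs) (flatten ps) & uniq (flatten ps)].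
  by move: uniq_vps; rewrite cat_uniq => /and3P.
have ltvs (x : 'I_(sumn [:: k; 1; 1; 1; 1; 1])) : x < size vs.
  by rewrite size_vs; exact: (ltn_ord x).
apply: (@embed_subdivision 'I_(sumn [:: k; 1; 1; 1; 1; 1]) _ _ _
          (fun x => nth s1 vs x) (fun x y => nth [::] ps (j x y))).
- by move=> x y /eqP; rewrite nth_uniq // => /eqP; apply: val_inj.
- move=> x y _; split.
    exact: uniq_flatten_nth.
  move=> z; apply/negP => /= pz; have : nth s1 vs z \in flatten ps.
    apply/flattenP; exists (nth [::] ps (j x y)) => //; rewrite mem_nth // ltnNge.
    by apply: contraL pz => ?; rewrite [nth [::] ps _]nth_default.
  by move/vs_ps/negP; apply; rewrite /= mem_nth.
- move=> x y x' y' Hxy Hxy' ne v /= vp.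
  have lt_j : j x y < 6.
    by rewrite ltnNge; apply: contraL vp => ?; rewrite nth_default.
  apply: (flatten_uniq_nth uniq_ps _ vp) => eq_j; apply: ne.
  suff [? ?] : x = x' :> nat /\ y = y' :> nat by congr pair; apply: val_inj.
  have ej := hexagon_indexP (oriented_hexagonP Hxy) lt_j.
  rewrite eq_j in lt_j; have ej' := hexagon_indexP (oriented_hexagonP Hxy') lt_j.
  by rewrite -[hexagon_index k x y]/(j x y) eq_j ej' in ej; case: ej.
- move=> x y Hxy /=.
  have f_k : nth s1 vs k = t1 by rewrite -[k]addn0 vs_ge.
  have f_k1 : nth s1 vs k.+1 = s2 by rewrite -addn1 vs_ge.
  have f_k2 : nth s1 vs k.+2 = t2 by rewrite -addn2 vs_ge.
  have f_k3 : nth s1 vs k.+3 = s3 by rewrite -addn3 vs_ge.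
  have f_k4 : nth s1 vs k.+4 = t3 by rewrite -addn4 vs_ge.
  case/oriented_hexagonP: Hxy => -[ex ey].
  + move: (nat_of_ord x) (nat_of_ord y) ex ey => i _ ex ->.
    rewrite vs_lt // /j /hexagon_index; have [ik|ki] := ltnP i.+1 k.
      have [-> -> ->] : [/\ (i.+1 == k) = false, (i == k.+1) = false & (i == k.+3) = false].
        by clear -ik; split; lia.
      have -> : (i == 0) && (i.+1 == k.+4) = false by clear -ik; lia.
      have ip : i < size p by clear -ik size_p; lia.
      move/pathP: P0 => /(_ s1 i); rewrite size_rcons ltnS (ltnW ip) => /(_ isT).
      by rewrite vs_lt //= andbT nth_rcons ip -rcons_cons nth_rcons /= ltnS (ltnW ip).
    (* The last arc of the long block is replaced by the remainder of [s1 :: p], followed by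
       [t1]. *)
    have ek : i.+1 = k by apply/eqP; rewrite eqn_leq ex ki.
    rewrite ek f_k eqxx /= -ek.
    have ip : i < size (s1 :: p) by rewrite /= ltnS -ltnS ek.
    have : sorted D (drop i (rcons (s1 :: p) t1)) by apply: drop_sorted.
    by rewrite (drop_rcons (ltnW ip)) (drop_nth s1 ip).
  + rewrite ex f_k1 /j /hexagon_index eqxx; have -> /= : (k.+2 == k) = false by clear; lia.
    case: ey => ->; rewrite ?f_k ?f_k2 ?eqxx //.
    by have -> : (k.+2 == k) = false by clear; lia.
  + rewrite ex f_k3 /j /hexagon_index eqxx.
    have [-> -> /=] : (k.+4 == k) = false /\ (k.+3 == k.+1) = false by clear; split; lia.
    case: ey => ->; rewrite ?f_k2 ?f_k4 ?eqxx //.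
    by have -> : (k.+4 == k.+2) = false by clear; lia.
  + rewrite ex ey f_k4 /j /hexagon_index.
    have -> : (k.+4 == k) = false by clear; lia.
    by rewrite andbF /= eqxx vs_lt.
Qed.

(** * Colourings *)

Definition proper_colorable (T : finType) (G : rel T) (n : nat) : Prop :=
  exists c : T -> nat, (forall x, c x < n) /\ forall x y, G x y -> c x <> c y.

Lemma chromatic_number_le (T : finType) (D : rel T) (irrD : irreflexive D) n :
  proper_colorable D n -> chromatic_number irrD <= n.
Proof.
case=> c [c_lt c_prop]; rewrite /chromatic_number /graph_chromatic_number.
case: ex_minnP => m _; apply; apply/existsP; exists [ffun x => Ordinal (c_lt x)].
apply/forallP=> x; apply/forallP=> y; apply/implyP; rewrite !ffunE.
by case/orP=> /c_prop ne; apply/eqP => -[] //; apply/nesym.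
Qed.

Lemma proper_colorableW (T : finType) (G : rel T) m n :
  m <= n -> proper_colorable G m -> proper_colorable G n.
Proof.
move=> le_mn [c [c_lt c_prop]]; exists c; split=> // x.
exact: leq_trans le_mn.
Qed.

Lemma proper_colorable0 (T : finType) (G : rel T) n :
  0 < n -> (forall x y, ~~ G x y) -> proper_colorable G n.
Proof. by move=> n_gt0 G0; exists (fun=> 0); split=> // x y Gxy; case/negP: (G0 x y). Qed.

Lemma proper_colorableU (T : finType) (G G1 G2 : rel T) (m n : nat) :
  (forall x y, G x y -> G1 x y || G2 x y) ->
  proper_colorable G1 m -> proper_colorable G2 n -> proper_colorable G (m * n).
Proof.
(* The pair of colours is encoded in base [m]. *)
move=> sub [c1 [lt1 p1]] [c2 [lt2 p2]]; exists (fun x => c1 x + m * c2 x).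
split=> [x|x y /sub Gxy eq_c].
  by have := lt1 x; have := lt2 x; nia.
have m_gt0 : 0 < m := leq_trans (ltn0Sn _) (lt1 x).
have : c1 x = c1 y.
  by rewrite -(modn_small (lt1 x)) -(modn_small (lt1 y)) -(modnMDl (c2 x)) addnC
     -(modnMDl (c2 y) (c1 y)) [_ * m + c1 y]addnC ![_ * m]mulnC eq_c.
move=> e1; have e2 : c2 x = c2 y by apply/eqP; rewrite -(eqn_pmul2l m_gt0); lia.
by case/orP: Gxy => [/p1|/p2].
Qed.

Lemma proper_colorable_sym (T : finType) (G : rel T) n :
  proper_colorable (fun x y => G y x) n -> proper_colorable G n.
Proof. by case=> c [c_lt cP]; exists c; split=> // x y /cP/nesym. Qed.

(** Vertices are coloured by increasing [r]: only the at most [d] in-neighbours constrain a vertex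
    when its turn comes. *)
Lemma greedy_coloring (T : finType) (G : rel T) (r : T -> nat) (d : nat) :
  (forall x y, G x y -> r x < r y) -> (forall y, #|[set x | G x y]| <= d) ->
  proper_colorable G d.+1.
Proof.
move=> r_mono indeg.
suff H m : exists c : T -> nat, (forall x, c x <= d) /\
    forall x y, G x y -> r y < m -> c x <> c y.
  have [c [c_le cP]] := H (\max_x r x).+1.
  by exists c; split=> // x y Gxy; apply: cP => //; rewrite ltnS leq_bigmax.
elim: m => [|m [c [c_le cP]]]; first by exists (fun=> 0).
have free y : exists n : 'I_d.+1, n \notin [set inord (c x) | x in [set x | G x y]].
  apply/existsP; rewrite -negb_forall; apply/negP => /forallP full.
  have := leq_trans (leq_imset_card (fun x => inord (c x) : 'I_d.+1) _) (indeg y).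
  rewrite (_ : [set _ | _ in _] = setT) ?cardsT ?card_ord ?ltnn //.
  by apply/setP => n; rewrite full inE.
(* All vertices of rank [m] are recoloured at once; no arc joins two of them. *)
pose c' y := if r y == m then val (xchoose (free y)) else c y.
exists c'; split=> [x|x y Gxy].
  by rewrite /c'; case: eqP => _ //; rewrite -ltnS ltn_ord.
rewrite /c' ltnS leq_eqVlt; have rxy := r_mono _ _ Gxy; case: (r y =P m) => [ry _|_ ry].
  rewrite ifN; last by apply/eqP; lia.
  have := xchooseP (free y); apply: contraNnot => cxy.
  apply/imsetP; exists x; first by rewrite inE.
  by apply: val_inj; rewrite /= inordK // ltnS.
by rewrite ifN; [apply: cP | apply/eqP; lia].
Qed.

(** The arcs set aside have no [R]-smaller tail at their head. As [R] is total, at most one of them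
    enters each vertex, so two colours suffice for them; every remaining arc has a companion with
    the same head. *)
Lemma split_in (T : finType) (G R : rel T) (r : T -> nat) n :
  (forall x y, G x y -> r x < r y) -> (forall x y, x != y -> R x y || R y x) ->
  proper_colorable (fun x y => G x y && [exists x', G x' y && R x' x]) n ->
  proper_colorable G (2 * n).
Proof.
move=> r_mono R_total; apply: (@proper_colorableU _ _
  (fun x y => G x y && ~~ [exists x', G x' y && R x' x])) => [x y ->|].
  by rewrite orNb.
apply: (@greedy_coloring _ _ r) => [x y /andP[/r_mono]|y] //.
rewrite leqNgt; apply/negP => /card_gt1P[x1 [x2 []]].
rewrite !inE => /andP[G1 N1] /andP[G2 N2] /R_total /orP[R12|R21].
  by case/negP: N2; apply/existsP; exists x1; rewrite G1.
by case/negP: N1; apply/existsP; exists x2; rewrite G2.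
Qed.

(** This is [split_in] for the reversed digraph, with the ranks turned upside down. *)
Lemma split_out (T : finType) (G R : rel T) (r : T -> nat) n :
  (forall x y, G x y -> r x < r y) -> (forall x y, x != y -> R x y || R y x) ->
  proper_colorable (fun x y => G x y && [exists y', G x y' && R y' y]) n ->
  proper_colorable G (2 * n).
Proof.
move=> r_mono R_total col; apply: proper_colorable_sym.
have r_max x : r x <= \max_z r z by exact: leq_bigmax.
apply: (@split_in _ _ R (fun x => \max_z r z - r x)) => //.
  by move=> x y /r_mono; have := r_max x; have := r_max y; lia.
exact: proper_colorable_sym.
Qed.

(** * Out-trees *)

(** Levels encode that the tree is acyclic and spanning: climbing with [p] lowers them by one until
    [r] is reached. *)
Record out_tree (T : finType) (D : rel T) (r : T) (p : T -> T) (lev : T -> nat) :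
    Prop := OutTree {
  lev_root : lev r = 0;
  lev_parent : forall v, v != r -> lev v = (lev (p v)).+1;
  arc_parent : forall v, v != r -> D (p v) v }.

Definition ancestor (T : finType) (p : T -> T) (lev : T -> nat) (u v : T) : bool :=
  (lev u <= lev v) && (iter (lev v - lev u) p v == u).

Section OutTree.

Variables (T : finType) (D : rel T) (r : T) (p : T -> T) (lev : T -> nat).
Hypothesis tree : out_tree D r p lev.

Local Notation anc := (ancestor p lev).

Lemma anc_lev u v : anc u v -> lev u <= lev v.
Proof. by case/andP. Qed.

Lemma anc_refl u : anc u u.
Proof. by rewrite /ancestor leqnn subnn /=. Qed.

Lemma lev_iter i v : i <= lev v -> lev (iter i p v) = lev v - i.
Proof.
elim: i => [|i IHi] i_lt; first by rewrite subn0.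
have e := IHi (ltnW i_lt); rewrite iterS.
have : iter i p v != r.
  by apply: contraTneq i_lt => ei; move: e; rewrite ei (lev_root tree); lia.
by move/(lev_parent tree); lia.
Qed.

Lemma anc_eq u v : anc u v -> lev v <= lev u -> u = v.
Proof. by case/andP=> l1 /eqP e l2; rewrite -e (_ : lev v - lev u = 0) //; lia. Qed.

Lemma anc_trans u v w : anc u v -> anc v w -> anc u w.
Proof.
case/andP=> l1 /eqP e1 /andP[l2 /eqP e2]; rewrite /ancestor (leq_trans l1 l2) /=.
by rewrite -[X in _ == X]e1 -{2}e2 -iterD; apply/eqP; congr iter; lia.
Qed.

Lemma anc_chain u v w : anc u w -> anc v w -> lev u <= lev v -> anc u v.
Proof.
case/andP=> l1 /eqP e1 /andP[l2 /eqP e2] l3; rewrite /ancestor l3 /=.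
by rewrite -[X in _ == X]e1 -{2}e2 -iterD; apply/eqP; congr iter; lia.
Qed.

Lemma anc_total u v w : anc u w -> anc v w -> anc u v || anc v u.
Proof.
by move=> uw vw; case: (leqP (lev u) (lev v)) => [|/ltnW] l;
  apply/orP; [left | right]; apply: anc_chain l; eassumption.
Qed.

Lemma lev0 v : lev v = 0 -> v = r.
Proof. by move=> e; apply/eqP; apply: contra_eqT e => /(lev_parent tree)->. Qed.

Lemma anc_root v : anc r v.
Proof.
rewrite /ancestor (lev_root tree) subn0 /=; apply/eqP/lev0.
by rewrite lev_iter // subnn.
Qed.

Lemma anc_parent u v : v != r -> anc u v = (u == v) || anc u (p v).
Proof.
move=> vr; have e := lev_parent tree vr; case: eqP => [->|ne] /=; first exact: anc_refl.
rewrite /ancestor; case: (leqP (lev u) (lev v)) => l1; last first.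
  by rewrite (_ : _ <= _ = false) //; lia.
case: (leqP (lev u) (lev (p v))) => l2 /=.
  by rewrite (_ : lev v - lev u = (lev (p v) - lev u).+1) ?iterSr //; lia.
by rewrite (_ : lev v - lev u = 0) /=; [apply/eqP/nesym | lia].
Qed.

(** The vertices between [v] and the root have distinct levels. This bounds the sum maximized in
    [exists_final_tree]. *)
Lemma lev_lt_card v : lev v < #|T|.
Proof.
rewrite -[X in X <= _]card_ord.
apply: (@leq_card _ _ (fun i : 'I_(lev v).+1 => iter i p v)) => i j /(congr1 lev).
have := ltn_ord i; have := ltn_ord j => lj li; rewrite !lev_iter // => e.
by apply: val_inj => /=; lia.
Qed.

(** The membership clause reduces the disjointness of tree paths to levels and ancestry. *)
Lemma tree_segment u v : anc u v -> exists q,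
  [/\ path D u q, last u q = v, size q = lev v - lev u, uniq (u :: q)
    & forall w, (w \in u :: q) = anc u w && anc w v].
Proof.
move En: (lev v - lev u) => n; elim: n v En => [|n IHn] v En uv.
  have <- : u = v by apply: anc_eq uv _; lia.
  exists [::]; split=> // w; rewrite inE; apply/eqP/andP => [->|[uw wu]].
    by rewrite anc_refl.
  by apply/esym/(anc_eq uw)/anc_lev.
have vr : v != r by apply: contra_eqN En => /eqP->; rewrite (lev_root tree).
have lv := lev_parent tree vr.
have ne : u != v by apply: contra_eqN En => /eqP->; rewrite subnn.
have upv : anc u (p v) by move: uv; rewrite anc_parent // (negPf ne).
have [|q [Dq lq sq uq mq]] := IHn (p v) _ upv; first lia.
have memq w : (w \in u :: rcons q v) = anc u w && anc w v.
  rewrite -rcons_cons mem_rcons in_cons mq (anc_parent _ vr).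
  by case: eqP => [->|] /=; rewrite ?uv.
exists (rcons q v); split; rewrite ?last_rcons ?size_rcons ?sq //.
  by rewrite rcons_path Dq lq (arc_parent tree).
rewrite -rcons_cons rcons_uniq uq andbT mq; apply/negP => /andP[_ /anc_lev].
by lia.
Qed.

(** The subtree of [y] is hung below [x]. As [x] lies outside it, no cycle arises and [lev x] is
    kept, while the whole subtree moves strictly down. *)
Lemma reparent x y : D x y -> lev y <= lev x -> ~~ anc y x ->
  exists p' lev', out_tree D r p' lev' /\ \sum_v lev v < \sum_v lev' v.
Proof.
move=> Dxy le_yx yx.
have yr : y != r by apply: contraNneq yx => ->; apply: anc_root.
exists (fun v => if v == y then x else p v).
exists (fun v => if anc y v then lev v + ((lev x).+1 - lev y) else lev v).
split; last first.
  rewrite (bigD1 y) //= [X in _ < X](bigD1 y) //= anc_refl -addSn leq_add //; first lia.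
  by apply: leq_sum => v _; case: ifP => // _; apply: leq_addr.
split=> [|v vr|v vr].
- rewrite (negPf (_ : ~~ anc y r)) ?(lev_root tree) //; apply: contraNN yr => yr.
  by apply/eqP/(anc_eq yr); rewrite (lev_root tree).
- case: (eqVneq v y) => [->|vy]; first by rewrite anc_refl (negPf yx); lia.
  by rewrite (anc_parent _ vr) eq_sym (negPf vy) /= (lev_parent tree vr); case: ifP.
by case: eqP => [->|_] //; apply: (arc_parent tree).
Qed.

End OutTree.

(** Breadth-first tree: levels are distances from [r]. *)
Lemma connect_out_tree (T : finType) (D : rel T) (r : T) :
  (forall v, connect D r v) -> exists p lev, out_tree D r p lev.
Proof.
move=> conn; pose walk n v := [exists t : n.-tuple T, path D r t && (last r t == v)].
have walkP q : path D r q -> walk (size q) (last r q).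
  by move=> Dq; apply/existsP; exists (in_tuple q); rewrite Dq eqxx.
have ex_walk v : exists n, walk n v.
  by case/connectP: (conn v) => q Dq ->; exists (size q); apply: walkP.
pose lev v := ex_minn (ex_walk v).
have lev_le q : path D r q -> lev (last r q) <= size q.
  by move/walkP; rewrite /lev; case: ex_minnP => n _; apply.
have geodesic v : exists q, [/\ path D r q, last r q = v & size q = lev v].
  rewrite /lev; case: ex_minnP => n /existsP[t /andP[Dt /eqP lt]] _.
  by exists t; rewrite size_tuple.
have par v : v != r -> [exists u, D u v && (lev v == (lev u).+1)].
  move=> vr; have [q [Dq lq sq]] := geodesic v.
  case/lastP: q => [|q w] in Dq lq sq *; first by rewrite -lq eqxx in vr.
  move: lq; rewrite last_rcons => ew; rewrite {w}ew in Dq sq *.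
  move: (Dq); rewrite rcons_path => /andP[Dq' Duv].
  have [q' [Dq'' lq' sq']] := geodesic (last r q).
  have := lev_le (rcons q' v).
  rewrite rcons_path Dq'' lq' Duv last_rcons size_rcons sq' => /(_ isT) le1.
  have := lev_le _ Dq'; move: sq; rewrite size_rcons => e le2.
  by apply/existsP; exists (last r q); rewrite Duv; apply/eqP; lia.
(* The default is taken only at the root, whose level is 0. *)
exists (fun v => odflt v [pick u | D u v && (lev v == (lev u).+1)]), lev; split.
- by apply/eqP; rewrite -leqn0; apply: (lev_le [::]).
- move=> v /par /existsP[u uP]; case: pickP => [w /andP[_ /eqP]|/(_ u)] //=.
  by rewrite uP.
move=> v /par /existsP[u uP]; case: pickP => [w /andP[]|/(_ u)] //=.
by rewrite uP.
Qed.

(** Reparenting terminates, since the sum of the levels grows and is bounded; a tree that cannot be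
    improved has the property. *)
Lemma exists_final_tree (T : finType) (D : rel T) (r : T) :
  (forall v, connect D r v) -> exists p lev, out_tree D r p lev /\
    forall x y, D x y -> lev x < lev y \/ ancestor p lev y x.
Proof.
move=> /connect_out_tree[p [lev tree]].
have sum_le p' lev' : out_tree D r p' lev' -> \sum_v lev' v <= #|T| * #|T|.
  move=> tree'; rewrite -[X in _ <= X * _]sum1_card big_distrl /=.
  by apply: leq_sum => v _; rewrite mul1n ltnW // (lev_lt_card tree').
move En: (#|T| * #|T| - \sum_v lev v) => n.
elim/ltn_ind: n => n IHn in p lev tree En *.
have [/existsP[x /existsP[y /and3P[Dxy le_yx yx]]]|fin] :=
  boolP [exists x, exists y, [&& D x y, lev y <= lev x & ~~ ancestor p lev y x]].
  have [p' [lev' [tree' lt_sum]]] := reparent tree Dxy le_yx yx.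
  by apply: (IHn _ _ p' lev' tree' erefl); have := sum_le _ _ tree'; lia.
exists p, lev; split=> // x y Dxy; case: (leqP (lev y) (lev x)) => [le_yx|]; last by left.
right; apply: contraNT fin => yx.
by apply/existsP; exists x; apply/existsP; exists y; rewrite Dxy le_yx.
Qed.

Lemma uniq_catI (T : eqType) (s1 s2 : seq T) :
  uniq s1 -> uniq s2 -> (forall w, w \in s1 -> w \in s2 -> False) ->
  uniq (s1 ++ s2).
Proof.
move=> u1 u2 disj; rewrite cat_uniq u1 u2 andbT /=.
by apply/hasPn => w w2; apply/negP => w1; apply: disj w1 w2.
Qed.

(** * Consecutive jumps along a branch *)

Section Jumps.

Variables (T : finType) (D : rel T) (r : T) (p : T -> T) (lev : T -> nat).
Hypothesis tree : out_tree D r p lev.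
Local Notation anc := (ancestor p lev).

Variable J : rel T.
Hypothesis J_anc : forall s t, J s t -> anc s t.
Hypothesis J_lev : forall s t, J s t -> lev s < lev t.

(** Successive jumps do not overlap but, [anc] being reflexive, one may start where the previous one
    ended. *)
Fixpoint jumps (n : nat) (y x : T) : bool :=
  if n is m.+1 then [exists s, exists t, [&& anc y s, J s t & jumps m t x]]
  else anc y x.

Lemma jumpsSP n y x :
  reflect (exists s t, [/\ anc y s, J s t & jumps n t x]) (jumps n.+1 y x).
Proof.
apply: (iffP existsP) => [[s /existsP[t /and3P[ys st tx]]]|[s [t [ys st tx]]]].
  by exists s, t.
by exists s; apply/existsP; exists t; rewrite ys st.
Qed.

Lemma jumps_ancl n y' y x : anc y' y -> jumps n y x -> jumps n y' x.
Proof.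
case: n => [|n] y'y; first exact: anc_trans y'y.
case/jumpsSP=> s [t [ys st tx]]; apply/jumpsSP; exists s, t; split=> //.
exact: anc_trans y'y ys.
Qed.

Lemma jumps_lev n y x : jumps n y x -> n + lev y <= lev x.
Proof.
elim: n y => [|n IHn] y; first by apply: anc_lev.
by case/jumpsSP=> s [t [/anc_lev ys /J_lev st /IHn]]; lia.
Qed.

Lemma jumps_le m n y x : m <= n -> jumps n y x -> jumps m y x.
Proof.
elim: n m y => [|n IHn] m y; first by case: m.
move=> le_mn /jumpsSP[s [t [ys st tx]]].
have yt : anc y t by apply: anc_trans ys (J_anc st).
case: m le_mn => [|m] le_mn; first by apply: jumps_ancl yt (IHn 0 t _ tx).
by apply/jumpsSP; exists s, t; split=> //; apply: IHn tx.
Qed.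

(** At most one jump straddles [y]; its loss accounts for [i.+1]. *)
Lemma jumps_split n u y x : anc u y -> anc y x -> jumps n u x ->
  exists2 i, jumps i u y & jumps (n - i.+1) y x.
Proof.
move=> uy yx; elim: n u uy => [|n IHn] u uy; first by exists 0.
case/jumpsSP=> s [t [us st tx]].
have tx' : anc t x := jumps_le (leq0n n) tx.
case/orP: (anc_total tx' yx) => [ty|yt].
  have [i ity ixy] := IHn t ty tx; exists i.+1 => //.
  by apply/jumpsSP; exists s, t.
by exists 0; rewrite // subn1; apply: jumps_ancl yt tx.
Qed.

(** [f x] is the largest number of jumps from the root to [x]. An optimal chain to [x], cut at [y],
    has at most [f y] jumps above [y] and loses at most one. *)
Lemma jump_height : exists f : T -> nat,
  [/\ forall s t, J s t -> f s < f t,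
      forall y x, anc y x -> f y <= f x
    & forall m y x, anc y x -> f y + m < f x -> jumps m y x].
Proof.
have ex0 x : exists n, jumps n r x by exists 0; apply: anc_root tree x.
have bnd x n : jumps n r x -> n <= lev x by move/jumps_lev; lia.
exists (fun x => ex_maxn (ex0 x) (bnd x)); split.
- move=> s t st; case: ex_maxnP => n ns _; case: ex_maxnP => m mt; apply.
  elim: n (r) ns => [|n IHn] u.
    by move=> us; apply/jumpsSP; exists s, t; split=> //; apply: anc_refl.
  by case/jumpsSP=> s' [t' [us' st' /IHn ts]]; apply/jumpsSP; exists s', t'.
- move=> y x yx; case: ex_maxnP => n ny _; case: ex_maxnP => m mx; apply.
  elim: n (r) ny => [|n IHn] u; first by move=> uy; apply: anc_trans uy yx.
  by case/jumpsSP=> s' [t' [us' st' /IHn ts]]; apply/jumpsSP; exists s', t'.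
move=> m y x yx; case: ex_maxnP => n ny maxn; case: ex_maxnP => n' nx _ lt_m.
have [i iy ix] := jumps_split (anc_root tree y) yx nx.
by apply: jumps_le ix; have := maxn _ iy; lia.
Qed.

End Jumps.

(** * Six-block cycles made of branches and arcs *)

Section Hexagons.

Variables (T : finType) (D : rel T) (r : T) (p : T -> T) (lev : T -> nat).
Hypothesis tree : out_tree D r p lev.
Local Notation anc := (ancestor p lev).

Variable k : nat.
Hypothesis k_gt0 : 0 < k.

Local Notation has_hexagon :=
  (contains_subdivision (oriented_cycle [:: k; 1; 1; 1; 1; 1]) D).

Lemma tree_segment_lt u v : anc u v -> lev u < lev v -> exists q,
  [/\ path D u (rcons q v), (size q).+1 = lev v - lev u, uniq (u :: rcons q v)
    & forall w, w \in u :: rcons q v -> anc u w /\ anc w v].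
Proof.
move=> uv lt_uv; have [q [Dq lq sq uq mq]] := tree_segment tree uv.
case/lastP: q => [|q w] in Dq lq sq uq mq *; first by move: sq => /=; lia.
move: lq; rewrite last_rcons => lq; rewrite {w}lq size_rcons in Dq sq uq mq *.
by exists q; split=> // w; rewrite mq => /andP.
Qed.

(** Sources [e], [c], [t], sinks [d], [b], [s], long block from [e] to [d]. The block from [t] to
    [s] passes through the arc [x -> y]. The tree paths occupy disjoint ranges of levels. *)
Lemma back_hexagon y s e d c b t x : anc y s -> anc e d -> anc c b -> anc t x ->
  lev s < lev e -> lev e + k <= lev d -> lev d < lev c -> lev c < lev b ->
  lev b < lev t -> D x y -> D e s -> D c d -> D t b -> has_hexagon.
Proof.
move=> ys ed cb tx lt_se le_ed lt_dc lt_cb lt_bt Dxy Des Dcd Dtb.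
have lt_ed : lev e < lev d by clear -le_ed k_gt0; lia.
have [q1 [P1 S1 U1 M1]] := tree_segment_lt ed lt_ed.
have [q2 [P2 S2 U2 M2]] := tree_segment_lt cb lt_cb.
have [q3 [P3 L3 _ U3 M3]] := tree_segment tree tx.
have [q4 [P4 L4 _ U4 M4]] := tree_segment tree ys.
have size_q1 : k <= (size q1).+1 by rewrite S1; clear -le_ed; lia.
have P5 : path D t (rcons (q3 ++ belast y q4) s).
  by rewrite rcons_cat -L4 -lastI cat_path P3 L3 /= Dxy.
apply: (hexagon_subdivision (s2 := c) (t2 := b) (s3 := t) (t3 := s) (q1 := [::])
  (q3 := [::]) (q5 := [::]) k_gt0 size_q1 P1 _ P2 _ P5 _);
  try by rewrite /= andbT.
have : uniq ((y :: q4) ++ (e :: rcons q1 d) ++ (c :: rcons q2 b) ++ (t :: q3)).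
  have lev3 w : w \in t :: q3 -> lev t <= lev w by rewrite M3 => /andP[/anc_lev].
  have lev2 w : w \in c :: rcons q2 b -> lev c <= lev w <= lev b.
    by case/M2=> /anc_lev-> /anc_lev->.
  have lev1 w : w \in e :: rcons q1 d -> lev e <= lev w <= lev d.
    by case/M1=> /anc_lev-> /anc_lev->.
  have lev4 w : w \in y :: q4 -> lev w <= lev s by rewrite M4 => /andP[_ /anc_lev].
  apply: uniq_catI => //; last first.
    move=> w /lev4 l4; rewrite !mem_cat => /or3P[/lev1|/lev2|/lev3];
      clear -l4 lt_se lt_ed lt_dc lt_cb lt_bt; lia.
  apply: uniq_catI => //; last first.
    by move=> w /lev1 l1; rewrite !mem_cat => /orP[/lev2|/lev3];
      clear -l1 lt_se lt_ed lt_dc lt_cb lt_bt; lia.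
  by apply: uniq_catI => // w /lev2 l2 /lev3; clear -l2 lt_bt; lia.
congr is_true; apply/perm_uniq; rewrite lastI L4; perm_count.
Qed.

(** Sources [b1], [y], [b2], sinks [a1], [x], [a2], long block from [b1] to [a1]. Levels separate
    the tree paths, except that [~~ anc t1 a1] keeps the long block away from everything below [t1],
    and [~~ anc t2 a2] separates the last two. *)
Lemma down_hexagon y s1 b1 a1 t1 s2 b2 a2 t2 x :
  anc y s1 -> lev s1 < lev b1 -> anc b1 a1 -> lev b1 + k <= lev a1 ->
  lev b1 < lev t1 -> ~~ anc t1 a1 ->
  anc t1 s2 -> anc s2 b2 -> lev s2 < lev b2 -> anc b2 a2 -> lev b2 < lev a2 ->
  anc b2 t2 -> lev b2 < lev t2 -> ~~ anc t2 a2 -> anc t2 x ->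
  D y x -> D s1 a1 -> D b1 t1 -> D s2 a2 -> D b2 t2 -> has_hexagon.
Proof.
move=> ys1 lt_sb1 ba1 le_ba1 lt_bt1 ta1 ts sb2 lt_sb2 ba2 lt_ba2 bt2 lt_bt2 ta2 tx.
move=> Dyx Dsa1 Dbt1 Dsa2 Dbt2.
have lt_ba1 : lev b1 < lev a1 by clear -le_ba1 k_gt0; lia.
have [q1 [P1 S1 U1 M1]] := tree_segment_lt ba1 lt_ba1.
have [q2 [P2 S2 U2 M2]] := tree_segment_lt ba2 lt_ba2.
have [q3 [P3 L3 _ U3 M3]] := tree_segment tree ys1.
have [q4 [P4 L4 _ U4 M4]] := tree_segment tree ts.
have [q5 [P5 L5 _ U5 M5]] := tree_segment tree tx.
have size_q1 : k <= (size q1).+1 by rewrite S1; clear -le_ba1; lia.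
have P6 : path D y (rcons q3 a1) by rewrite rcons_path P3 L3.
have P7 : path D b2 (rcons (belast t2 q5) x) by rewrite -L5 -lastI /= Dbt2.
have P8 : path D b1 (rcons (t1 :: q4) a2) by rewrite /= Dbt1 rcons_path P4 L4.
apply: (hexagon_subdivision (s2 := y) (t2 := x) (q2 := [::])
  k_gt0 size_q1 P1 P6 _ P7 P2 P8 _); first by rewrite /= andbT.
have : uniq ((y :: q3) ++ (b1 :: rcons q1 a1) ++ (t1 :: q4) ++
             (b2 :: rcons q2 a2) ++ (t2 :: q5)).
  have lt_ts2 := anc_lev ts.
  apply: uniq_catI => //; last first.
    move=> w; rewrite M3 => /andP[_ /anc_lev l3].
    rewrite !mem_cat => /or4P[/M1[/anc_lev l1 _]| |/M2[/anc_lev l2 _]|].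
    - by clear -l3 lt_sb1 l1; lia.
    - by rewrite M4 => /andP[/anc_lev l4 _]; clear -l3 l4 lt_sb1 lt_bt1; lia.
    - by clear -l3 lt_sb1 l2 lt_ts2 lt_sb2 lt_bt1; lia.
    by rewrite M5 => /andP[/anc_lev l5 _];
      clear -l3 lt_sb1 l5 lt_ts2 lt_sb2 lt_bt1 lt_bt2; lia.
  apply: uniq_catI => //; last first.
    move=> w /M1[_ wa1] w2; case/negP: ta1; apply: anc_trans wa1.
    move: w2; rewrite !mem_cat M4 M5 => /or3P[/andP[]//|/M2[bw _]|/andP[tw _]].
      by apply: anc_trans bw; apply: anc_trans sb2.
    by apply: anc_trans tw; apply: anc_trans bt2; apply: anc_trans sb2.
  apply: uniq_catI => //; last first.
    move=> w; rewrite M4 => /andP[_ /anc_lev l4]; rewrite mem_cat M5.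
    case/orP=> [/M2[/anc_lev l2 _]|/andP[/anc_lev l5 _]].
      by clear -l4 l2 lt_sb2; lia.
    by clear -l4 l5 lt_sb2 lt_bt2; lia.
  apply: uniq_catI => // w /M2[_ wa2]; rewrite M5 => /andP[tw _].
  by case/negP: ta2; apply: anc_trans wa2.
by congr is_true; apply/perm_uniq; rewrite (lastI t2) L5; perm_count.
Qed.

(** Two tree paths, [x1] to [v2] (the long block) and [x2] to [v3], are joined by four arcs. They
    are disjoint because [x2] is not above [v2]. *)
Lemma spine_hexagon x1 v2 x2 v3 x3 y : irreflexive D ->
  anc x1 v2 -> lev x1 + k <= lev v2 -> anc x2 v3 -> lev x2 < lev v3 ->
  D x2 v2 -> D x3 v3 -> D x3 y -> D x1 y ->
  ~~ anc x2 v2 -> ~~ anc x3 v2 -> ~~ anc x3 v3 -> ~~ anc x1 y -> ~~ anc x2 y ->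
  has_hexagon.
Proof.
move=> irrD xv1 le_xv1 xv2 lt_xv2 D22 D33 D3y D1y n22 n32 n33 n1y n2y.
have lt_xv1 : lev x1 < lev v2 by clear -le_xv1 k_gt0; lia.
have [q1 [P1 S1 U1 M1]] := tree_segment_lt xv1 lt_xv1.
have [q2 [P2 S2 U2 M2]] := tree_segment_lt xv2 lt_xv2.
have size_q1 : k <= (size q1).+1 by rewrite S1; clear -le_xv1; lia.
apply: (hexagon_subdivision (s2 := x2) (t2 := v3) (s3 := x3) (t3 := y) (q1 := [::])
  (q3 := [::]) (q4 := [::]) (q5 := [::]) k_gt0 size_q1 P1 _ P2 _ _ _ _);
  try by rewrite /= andbT.
have : uniq ((x1 :: rcons q1 v2) ++ (x2 :: rcons q2 v3) ++ [:: x3; y]).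
  apply: uniq_catI => //; last first.
    move=> w /M1[xw wv]; rewrite mem_cat !inE.
    case/or3P=> [/M2[x2w _]|/eqP e|/eqP e]; [case/negP: n22| case/negP: n32|case/negP: n1y].
    - exact: anc_trans wv.
    - by rewrite -e.
    by rewrite -e.
  apply: uniq_catI => //; last first.
    move=> w /M2[xw wv]; rewrite !inE.
    case/orP=> /eqP e; [case/negP: n33|case/negP: n2y]; by rewrite -e.
  by rewrite /= inE andbT; apply: contraTneq D3y => ->; rewrite irrD.
by congr is_true; apply/perm_uniq; perm_count.
Qed.

Lemma exists_lca u v : exists z, [/\ anc z u, anc z v &
  forall w, anc w u -> anc w v -> anc w z].
Proof.
have ru : anc r u && anc r v by rewrite !(anc_root tree).
case: (arg_maxnP (P := fun z => anc z u && anc z v) lev ru) => z /andP[zu zv] zmax.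
exists z; split=> // w wu wv; apply: (anc_chain wu zu).
by apply: zmax; rewrite wu wv.
Qed.

(** The zigzag from [y1] to [x3] is closed through the least common ancestor [z] of its ends, the
    third source besides [x1] and [x2]. The block from [z] to [y1] is long because [z] is no deeper
    than [x3], hence than [x1]. *)
Lemma zigzag_hexagon y1 x1 y2 x2 y3 x3 :
  D x1 y1 -> D x1 y2 -> D x2 y2 -> D x2 y3 -> D x3 y3 ->
  ~~ anc x1 y1 -> ~~ anc x2 y1 ->
  lev x1 + k <= lev y1 -> lev y1 <= lev y2 -> lev y1 <= lev y3 ->
  lev x3 <= lev x1 -> lev x3 <= lev x2 -> lev x2 <= lev x1 -> 
  uniq [:: x1; x2; x3] -> uniq [:: y1; y2; y3] -> has_hexagon.
Proof.
move=> D11 D12 D22 D23 D33 n11 n21 le_xy le12 le13 le31 le32 le21 ux uy.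
have [z [zy zx zmax]] := exists_lca y1 x3.
have lt_zy : lev z < lev y1 by move/anc_lev: zx; clear -le31 le_xy k_gt0; lia.
have [q1 [P1 S1 U1 M1]] := tree_segment_lt zy lt_zy.
have [q2 [P2 L2 _ U2 M2]] := tree_segment tree zx.
have size_q1 : k <= (size q1).+1.
  by rewrite S1; move/anc_lev: zx; clear -le31 le_xy; lia.
have P3 : path D z (rcons q2 y3) by rewrite rcons_path P2 L2.
apply: (hexagon_subdivision (s2 := x1) (t2 := y2) (s3 := x2) (t3 := y3) (q1 := [::])
  (q2 := [::]) (q3 := [::]) (q4 := [::]) k_gt0 size_q1 P1 _ _ _ _ P3 _);
  try by rewrite /= andbT.
rewrite /= !inE !negb_or !andbT in ux uy.
case/andP: ux => /andP[x12 x13] x23; case/andP: uy => /andP[y12 y13] y23.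
have lev_neq u v : lev u < lev v -> u != v by apply: contraTneq => ->; rewrite ltnn.
have : uniq ((z :: rcons q1 y1) ++ q2 ++ [:: x1; x2; y2; y3]).
  apply: uniq_catI => //; last first.
    move=> w w1; have [zw wy] := M1 _ w1; rewrite mem_cat !inE => /orP[w2|].
      have : w \in z :: q2 by rewrite inE w2 orbT.
      (* The two tree paths leaving [z] meet only in [z]. *)
      rewrite M2 => /andP[_ wx]; have e := anc_eq zw (anc_lev (zmax _ wy wx)).
      by move: U2; rewrite /= e w2.
    case/or4P=> /eqP e.
    - by case/negP: n11; rewrite -e.
    - by case/negP: n21; rewrite -e.
    - by case/eqP: y12; rewrite -e; apply/esym/(anc_eq wy); rewrite e.
    by case/eqP: y13; rewrite -e; apply/esym/(anc_eq wy); rewrite e.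
  apply: uniq_catI; first by case/andP: U2.
    rewrite /= !inE !negb_or x12 y23 !andbT !lev_neq //=;
      clear -le_xy le12 le13 le21 k_gt0; lia.
  move=> w w2; have : w \in z :: q2 by rewrite inE w2 orbT.
  rewrite M2 => /andP[_ wx]; have lwx := anc_lev wx; rewrite !inE.
  case/or4P=> /eqP e; rewrite {w w2}e in wx lwx.
  - by case/eqP: x13; apply: anc_eq wx _.
  - by case/eqP: x23; apply: anc_eq wx _.
  - by clear -lwx le31 le_xy le12 k_gt0; lia.
  by clear -lwx le31 le_xy le13 k_gt0; lia.
by congr is_true; apply/perm_uniq; perm_count.
Qed.

End Hexagons.

(** * Colouring the three kinds of arcs *)

Lemma sorted4_of_card (T : finType) (rho : T -> nat) (A : {set T}) :
  injective rho -> 3 < #|A| -> exists x1 x2 x3 x4,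
    [/\ x1 \in A, x2 \in A, x3 \in A & x4 \in A]
    /\ [/\ rho x1 < rho x2, rho x2 < rho x3 & rho x3 < rho x4].
Proof.
move=> rho_inj; pose s := sort (relpre rho leq) (enum A).
have memA x : x \in s -> x \in A by rewrite mem_sort mem_enum.
have : sorted ltn (map rho s).
  rewrite ltn_sorted_uniq_leq map_inj_uniq // sort_uniq enum_uniq /=.
  by rewrite sorted_map sort_sorted // => x y; apply: leq_total.
rewrite cardE -(size_sort (relpre rho leq)) -/s.
case: s memA => [|x1 [|x2 [|x3 [|x4 s]]]] //= memA /and4P[r12 r23 r34 _] _.
by exists x1, x2, x3, x4; split; split=> //; apply: memA; rewrite !inE eqxx ?orbT.
Qed.

Section Coloring.

Variables (T : finType) (D : rel T) (r : T) (p : T -> T) (lev : T -> nat).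
Hypothesis tree : out_tree D r p lev.
Hypothesis irrD : irreflexive D.
Variable k : nat.
Hypothesis k_gt0 : 0 < k.
Hypothesis no_hexagon :
  ~ contains_subdivision (oriented_cycle [:: k; 1; 1; 1; 1; 1]) D.
Local Notation anc := (ancestor p lev).

(** Refines the levels to a strict total order, so that extremal heads and tails are unique. *)
Definition rank (v : T) : nat := lev v * #|T| + enum_rank v.

Lemma rank_inj : injective rank.
Proof.
move=> u v /(congr1 (modn^~ #|T|)); rewrite /rank !modnMDl !modn_small ?ltn_ord //.
by move/val_inj/enum_rank_inj.
Qed.

Lemma rank_lev u v : rank u < rank v -> lev u <= lev v.
Proof.
apply: contraTT; rewrite -ltnNge -leqNgt => lt_vu.
apply: leq_trans (leq_trans (leq_mul lt_vu (leqnn #|T|)) (leq_addr _ _)).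
by rewrite /rank mulSn addnC leq_add2r ltnW.
Qed.

Lemma rank_total u v : u != v -> (rank u < rank v) || (rank v < rank u).
Proof. by move=> ne; rewrite -neq_ltn (inj_eq rank_inj). Qed.

Lemma rank_neq u v : rank u < rank v -> u != v.
Proof. by apply: contraTneq => ->; rewrite ltnn. Qed.

Definition back : rel T := fun x y => [&& D x y, anc y x & lev y + k <= lev x].
Definition down : rel T := fun x y => [&& D x y, anc x y & lev x + k <= lev y].
(** As [k > 0], the gap also keeps [y] from being above [x]: the ends are incomparable. *)
Definition cross : rel T := fun x y => [&& D x y, ~~ anc x y & lev x + k <= lev y].

Lemma back_colorable : proper_colorable back 6.
Proof.
pose J s t := back t s.
have J_anc s t : J s t -> anc s t by case/and3P.
have J_lev s t : J s t -> lev s < lev t by case/and3P=> _ _; clear -k_gt0; lia.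
have [f [f_lt _ f_jumps]] := jump_height tree J_anc J_lev.
exists (fun x => f x %% 6); split=> [x|x y xy eq_f]; first exact: ltn_pmod.
case: no_hexagon.
have [Dxy yx _] := and3P xy.
(* Equal residues and a strict increase force a difference of at least 6, hence five jumps. *)
have lt_f : f y + 5 < f x by have := f_lt _ _ xy; move: eq_f; clear; lia.
have /jumpsSP[s1 [t1 [ys1 J1]]] := f_jumps _ _ _ yx lt_f.
move=> /jumpsSP[s2 [t2 [ts2 J2]]] /jumpsSP[s3 [t3 [ts3 J3]]].
move=> /jumpsSP[s4 [t4 [ts4 J4]]] /jumpsSP[s5 [t5 [ts5 J5 tx]]].
have anc_step u s t v : anc u s -> J s t -> anc t v -> anc u v.
  by move=> us /J_anc st tv; apply: anc_trans tv; apply: anc_trans st.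
have lt_step u s t v : anc u s -> J s t -> anc t v -> lev u + k <= lev v.
  by move=> /anc_lev us /and3P[_ _ st] /anc_lev tv; clear -us st tv; lia.
have lt_ts := lt_step _ _ _ _ ts4 J4 ts5.
(* Jumps 1, 3 and 5 supply the arcs; jump 2 makes the long block long, and jump 4 keeps [t3]
   strictly above [s5]. *)
apply: (back_hexagon tree k_gt0 ys1 (anc_step _ _ _ _ ts2 J2 ts3)
  (anc_step _ _ _ _ ts4 J4 ts5) tx (J_lev _ _ J1) (lt_step _ _ _ _ ts2 J2 ts3)
  (J_lev _ _ J3) _ (J_lev _ _ J5) Dxy).
- by clear -lt_ts k_gt0; lia.
- by case/and3P: J1.
- by case/and3P: J3.
by case/and3P: J5.
Qed.

Lemma down_colorable : proper_colorable down 12.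
Proof.
have down_lev x y : down x y -> lev x < lev y.
  by case/and3P=> _ _; clear -k_gt0; lia.
(* A jump is a zigzag [s -> a <- b -> t] of down arcs; [down b a] also provides the length of the
   long block. *)
pose J s t := [exists b, exists a, [&& down s a, down b a, down b t,
                                       anc s b, lev s < lev b & ~~ anc t a]].
have JP s t : J s t -> exists b a, [/\ down s a, down b a, down b t & [/\ anc s b,
    lev s < lev b & ~~ anc t a]].
  by case/existsP=> b /existsP[a /and5P[sa ba bt sb /andP[lt_sb ta]]]; exists b, a.
have J_anc s t : J s t -> anc s t.
  by case/JP=> b [a [_ _ /and3P[_ bt _] [sb _ _]]]; apply: anc_trans bt.
have J_lev s t : J s t -> lev s < lev t.
  by case/JP=> b [a [_ _ /down_lev bt [_ sb _]]]; apply: ltn_trans bt.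
have [f [f_lt f_le f_jumps]] := jump_height tree J_anc J_lev.
pose G x y := down x y && (f x == f y).
apply: (@proper_colorableU _ _ (fun x y => f x %% 3 != f y %% 3) G 3 4) => [x y xy| |].
- rewrite /G xy /=; apply/orP; have [eq_f|] := eqVneq (f x %% 3) _; last by left.
  right; apply/negPn/negP => ne_f; case: no_hexagon.
  have [Dxy anc_xy _] := and3P xy.
  have lt_f : f x + 2 < f y.
    by move: (f_le _ _ anc_xy) (elimN eqP ne_f) eq_f; clear; lia.
  have /jumpsSP[s1 [t1 [xs1 J1]]] := f_jumps _ _ _ anc_xy lt_f.
  move=> /jumpsSP[s2 [t2 [ts2 J2 ty]]].
  have [b1 [a1 [/and3P[Dsa1 _ _] /and3P[_ ba1 lt_ba1] bt1 [sb1 lt_sb1 ta1]]]] := JP _ _ J1.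
  have [b2 [a2 [/and3P[Dsa2 _ _] ba2 bt2 [sb2 lt_sb2 ta2]]]] := JP _ _ J2.
  have [/and3P[Dbt1 _ _] /and3P[Dbt2 anc_bt2 _] /and3P[_ anc_ba2 _]] := And3 bt1 bt2 ba2.
  exact: (down_hexagon tree k_gt0 xs1 lt_sb1 ba1 lt_ba1 (down_lev _ _ bt1) ta1 ts2
    sb2 lt_sb2 anc_ba2 (down_lev _ _ ba2) anc_bt2 (down_lev _ _ bt2) ta2 ty).
- exists (fun x => f x %% 3); split=> [x|x y /eqP] //; exact: ltn_pmod.
(* After deleting the deepest head for each tail, then the deepest tail for each head, a surviving
   arc [s -> a] would have companions [b -> a] and [b -> t] forming a jump, although [f s = f t]. *)
apply: (@split_out _ _ (fun y' y => rank y < rank y') lev 2).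
- by move=> x y /andP[/down_lev].
- by move=> x y ne; rewrite orbC rank_total.
apply: (@split_in _ _ (fun x' x => rank x < rank x') lev 1).
- by move=> x y /andP[/andP[/down_lev]].
- by move=> x y ne; rewrite orbC rank_total.
apply: proper_colorable0 => // s a; apply/negP.
case/andP=> /andP[/andP[sa /eqP f_sa] _] /existsP[b /andP[]].
case/andP=> /andP[ba /eqP f_ba] /existsP[t /andP[/andP[bt /eqP f_bt] lt_at]] lt_sb.
have [[_ anc_sa _] [_ anc_ba _]] := (and3P sa, and3P ba).
have sb : anc s b := anc_chain anc_sa anc_ba (rank_lev lt_sb).
suff /f_lt : J s t by rewrite f_sa -f_ba f_bt ltnn.
apply/existsP; exists b; apply/existsP; exists a; rewrite sa ba bt sb /=.
apply/andP; split.
  rewrite ltn_neqAle (anc_lev sb) andbT; apply/negP => /eqP e.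
  by case/eqP: (rank_neq lt_sb); apply: anc_eq sb _; rewrite e.
apply/negP => ta; case/eqP: (rank_neq lt_at).
by apply/esym/(anc_eq ta)/rank_lev.
Qed.

Lemma cross_colorable : proper_colorable cross 32.
Proof.
have cross_lev x y : cross x y -> lev x < lev y.
  by case/and3P=> _ _; clear -k_gt0; lia.
(* Three splits cost a factor 2 each; the rest has in-degree at most 3 and takes 4 greedy
   colours. *)
apply: (@split_in _ _ (fun x' x => rank x' < rank x) lev 16) => //.
  exact: rank_total.
set G1 := fun x y => _.
have G1P x y : G1 x y -> cross x y /\ exists2 x', cross x' y & rank x' < rank x.
  by case/andP=> xy /existsP[x' /andP[x'y lt_x]]; split=> //; exists x'.
apply: (@split_out _ _ (fun y' y => rank y < rank y') lev 8).
- by move=> x y /G1P[/cross_lev].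
- by move=> x y ne; rewrite orbC rank_total.
set G2 := fun x y => _.
have G2P x y : G2 x y -> G1 x y /\ exists2 y', G1 x y' & rank y < rank y'.
  by case/andP=> xy /existsP[y' /andP[xy' lt_y]]; split=> //; exists y'.
apply: (@split_out _ _ (fun y' y => rank y' < rank y) lev 4).
- by move=> x y /G2P[/G1P[/cross_lev]].
- exact: rank_total.
set G3 := fun x y => _.
have G3P x y : G3 x y -> G2 x y /\ exists2 y', G2 x y' & rank y' < rank y.
  by case/andP=> xy /existsP[y' /andP[xy' lt_y]]; split=> //; exists y'.
have G2_cross x y : G2 x y -> cross x y by case/G2P=> /G1P[].
(* Otherwise [y1, x1, y, x2, y3, x3] is a forbidden zigzag: the second split provides the head [y3]
   beyond [y], the first one the tail [x3] before [x2]. *)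
have anc_low x1 x2 y y1 : G2 x1 y -> G2 x2 y -> rank x2 < rank x1 ->
    G2 x1 y1 -> rank y1 < rank y -> anc x2 y1.
  move=> x1y x2y lt_x x1y1 lt_y1; apply/negPn/negP => n21; case: no_hexagon.
  have [_ [y3 /G1P[/and3P[D23 _ _] [x3 /and3P[D33 _ _] lt_x3]] lt_y3]] := G2P _ _ x2y.
  have /and3P[D11 n11 l11] := G2_cross _ _ x1y1.
  have /and3P[D1 _ _] := G2_cross _ _ x1y; have /and3P[D2 _ _] := G2_cross _ _ x2y.
  have lt_x31 := ltn_trans lt_x3 lt_x; have lt_y13 := ltn_trans lt_y1 lt_y3.
  apply: (zigzag_hexagon tree k_gt0 D11 D1 D2 D23 D33 n11 n21 l11);
    rewrite ?rank_lev //= !inE !negb_or !andbT.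
    by rewrite (eq_sym x1 x2) (eq_sym x1 x3) (eq_sym x2 x3) !rank_neq.
  by rewrite !rank_neq.
apply: (@greedy_coloring _ _ lev) => [x y /G3P[/G2_cross/cross_lev]|y] //.
rewrite leqNgt; apply/negP => /(sorted4_of_card rank_inj)[x1 [x2 [x3 [x4]]]].
rewrite !inE => -[[/G3P[x1y _] /G3P[x2y [v2 xv2 lt_v2]] /G3P[x3y [v3 xv3 lt_v3]]
  /G3P[x4y [v4 xv4 lt_v4]]] [lt12 lt23 lt34]].
case: no_hexagon.
(* The fourth tail puts [x2] and [x3] on one branch, that of [v4]; so [x3] is not above [v2], since
   [x2] is not. *)
have anc_x23 : anc x2 x3.
  apply: (anc_chain (w := v4)) (rank_lev lt23).
    exact: anc_low x4y x2y (ltn_trans lt23 lt34) xv4 lt_v4.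
  exact: anc_low x4y x3y lt34 xv4 lt_v4.
have /and3P[D22 n22 l22] := G2_cross _ _ xv2.
have /and3P[D33 n33 l33] := G2_cross _ _ xv3.
have /and3P[D3 _ _] := G2_cross _ _ x3y.
have /and3P[D1 n1 _] := G2_cross _ _ x1y.
have /and3P[_ n2 _] := G2_cross _ _ x2y.
apply: (spine_hexagon tree k_gt0 irrD (anc_low _ _ _ _ x2y x1y lt12 xv2 lt_v2) _
  (anc_low _ _ _ _ x3y x2y lt23 xv3 lt_v3) _ D22 D33 D3 D1) => //.
- by move: (rank_lev lt12) l22; clear; lia.
- by move: (rank_lev lt23) l33 k_gt0; clear; lia.
by apply: contraNN n22; apply: anc_trans.
Qed.

End Coloring.

(** * Combining the three colourings with the levels modulo k *)

Theorem theorem7 (k : nat) (k_gt0 : 0 < k) (T : finType) (D : rel T)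
  (irrD : irreflexive D) (strongD : strongly_connected D)
  (noC : ~ contains_subdivision (oriented_cycle [:: k; 1; 1; 1; 1; 1]) D) :
  chromatic_number irrD <= 7 * 24 ^ 2 * k.
Proof.
apply: chromatic_number_le.
case: (pickP (xpredT : pred T)) => [r _|T0]; last first.
  by exists (fun=> 0); split=> x; have := T0 x.
have [p [lev [tree final]]] := exists_final_tree (strongD r).
have back_col := back_colorable tree k_gt0 noC.
have down_col := down_colorable tree k_gt0 noC.
have cross_col := cross_colorable tree irrD k_gt0 noC.
(* The product is [2304 * k], and the bound is [4032 * k]. *)
apply: (@proper_colorableW _ _ (k * (6 * (12 * 32)))); first by rewrite mulnC leq_mul.
apply: (@proper_colorableU _ _ (fun x y => lev x %% k != lev y %% k)
  (fun x y => [|| back D p lev k x y, down D p lev k x y | cross D p lev k x y])).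
- move=> x y Dxy; have [eq_lev /=|//] := eqVneq (lev x %% k) (lev y %% k).
  (* Distinct levels with equal residues differ by at least [k], the gap required of the three kinds
     of arcs. *)
  have class_lt u v : lev u %% k = lev v %% k -> lev u < lev v -> lev u + k <= lev v.
    move=> e lt_uv; have /dvdnP[q eq_q] : k %| lev v - lev u.
      by rewrite -eqn_mod_dvd 1?ltnW // e.
    by case: q eq_q => [|q]; clear -lt_uv; nia.
  case: (ltnP (lev x) (lev y)) => [lt_xy|le_yx].
    by rewrite /down /cross Dxy class_lt // !andbT /= orbN orbT.
  case: (final _ _ Dxy) => [|yx]; first by rewrite ltnNge le_yx.
  have ne : y != x by apply: contraTneq Dxy => ->; rewrite irrD.
  rewrite /back Dxy yx class_lt // ltn_neqAle le_yx andbT.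
  by apply: contraNN ne => /eqP e; apply/eqP/(anc_eq yx); rewrite e.
- by exists (fun x => lev x %% k); split=> [x|x y /eqP] //; exact: ltn_pmod.
apply: proper_colorableU (fun _ _ h => h) back_col _.
exact: proper_colorableU (fun _ _ h => h) down_col cross_col.
Qed.
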